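(* Let $n \geq 1$ and $k \geq 2$ be integers. Then $\vert \mathrm{PC}^k(n) \vert = \vert \mathbb{S}(\lambda,\rho) \vert$ for $\lambda = n^3 = (n,n,n)$ and $\rho = (1,k-1,1)$, where $\mathrm{PC}^k(n)$ is the set of closed $k$-ary product-coproduct prographs with exactly $n$ products and $n$ coproducts, and $\mathbb{S}(\lambda,\rho)$ is the set of standard set-valued Young tableaux of shape $\lambda$ and row-constant density $\rho$.
   Context: Tableaux. For a non-increasing sequence of positive integers $\lambda=(\lambda_1,\dots,\lambda_m)$, the Young diagram of shape $\lambda$ is the left-justified array of cells with $\lambda_i$ cells in the $i$-th row from the top (English notation); $(i,j)$ denotes the cell in row $i$, column $j$. Given $\rho=(\rho_1,\dots,\rho_m)$ with positive integer entries and $M=\sum_i \lambda_i\rho_i$, a set-valued Young tableau of shape $\lambda$ and (row-constant) density $\rho$ assigns each integer of $\{1,\dots,M\}$ to a cell so that every cell in row $i$ receives precisely $\rho_i$ integers (unordered within the cell). It is standard if for each cell $(i,j)$ every integer in cell $(i,j)$ is smaller than every integer in the cells $(i+1,j)$ and $(i,j+1)$ (whenever these exist). The set of these is $\mathbb{S}(\lambda,\rho)$. Prographs. Fix $k\ge 2$ and two formal operators: a $k$-ary coproduct $\Delta_k$ with $1$ input and $k$ outputs, and a $k$-ary product $\mu_k$ with $k$ inputs and $1$ output (no coassociativity, associativity or any other relation is imposed). A $k$-ary (product-coproduct) prograph is a directed plane graph representing a finite formal composition of copies of $\Delta_k$, $\mu_k$ and identity strands, beginning with a single input strand: all edges are directed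 strictly upward, each use of $\Delta_k$ is an internal node with $1$ incoming and $k$ outgoing edges, each use of $\mu_k$ is an internal node with $k$ incoming and $1$ outgoing edge, and graphs are considered up to planar isotopy keeping all edges directed upward (left-to-right order of the edges at each node, of the inputs and of the outputs is preserved). Equivalently: start with one strand, and repeatedly either replace one strand by $k$ consecutive strands (coproduct) or replace $k$ consecutive strands by one strand (product), where two such sequences are identified if they differ by interchanging consecutive operations acting on disjoint sets of strands (neither using an output of the other). A prograph is closed if it ends with exactly one output strand (a single terminal vertex); a closed prograph has equally many products and coproducts. *)

(* Defs.v *)
From HB Require Import structures.
From mathcomp Require Import all_boot.

Set Implicit Arguments.
Unset Strict Implicit.
Unset Printing Implicit Defensive.

(** * Standard set-valued Young tableaux *)

(* A filling is given by the map sending each integer to its cell; the ordinal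
   [t : 'I_M] stands for the integer [t.+1] of {1, ..., M}.  Rows and columns
   are numbered from 0. *)
Section Tableaux.

Variables (m : nat) (la rho : m.-tuple nat).

Definition cell : finType := {i : 'I_m & 'I_(tnth la i)}.

Definition row_of (c : cell) : 'I_m := tag c.
Definition col_of (c : cell) : nat := tagged c.

Definition nb_entries : nat := \sum_(i < m) tnth la i * tnth rho i.

Definition has_density (T : {ffun 'I_nb_entries -> cell}) : bool :=
  [forall c : cell, #|[set t | T t == c]| == tnth rho (row_of c)].

Definition below (c d : cell) : bool :=
  (row_of d == (row_of c).+1 :> nat) && (col_of d == col_of c).

Definition right_of (c d : cell) : bool :=
  (row_of d == row_of c) && (col_of d == (col_of c).+1).

Definition is_standard (T : {ffun 'I_nb_entries -> cell}) : bool :=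
  [forall s, forall t,
     (below (T s) (T t) || right_of (T s) (T t)) ==> (s < t)].

Definition standard_tableaux : {set {ffun 'I_nb_entries -> cell}} :=
  [set T | has_density T && is_standard T].

End Tableaux.

(** * Prographs *)

Inductive operator : Type := Coproduct | Product.

Definition bool_of_operator (o : operator) : bool :=
  if o is Coproduct then true else false.
Definition operator_of_bool (b : bool) : operator :=
  if b then Coproduct else Product.
Lemma bool_of_operatorK : cancel bool_of_operator operator_of_bool.
Proof. by case. Qed.

HB.instance Definition _ := Finite.copy operator (can_type bool_of_operatorK).

Section Prographs.

Variable k : nat.

Definition inputs (o : operator) : nat := if o is Coproduct then 1 else k.
Definition outputs (o : operator) : nat := if o is Coproduct then k else 1.

(* [(o, i)] applies [o] to the [inputs o] consecutive strands number
   i, i + 1, ... of the current configuration, counted from the left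
   starting at 0. *)
Definition step : Type := (operator * nat)%type.

Fixpoint runs (s : nat) (w : seq step) (t : nat) : bool :=
  match w with
  | [::] => s == t
  | (o, i) :: w' =>
      (i + inputs o <= s) && runs (s - inputs o + outputs o) w' t
  end.

(* [a] then [b] is replaced by [c] then [d], where [b] acts on strands lying
   strictly to the right of the outputs of [a], and [c], [d] are the same two
   operations in the opposite order.  The case where [b] lies to the left of
   [a] is the same relation read backwards. *)
Definition swaps (a b c d : step) : bool :=
  let: (o, i) := a in let: (o', j) := b in
  [&& i + outputs o <= j, c == (o', j - outputs o + inputs o) & d == (o, i)].

Fixpoint interchange1 (v w : seq step) : bool :=
  match v, w with
  | a :: v', c :: w' =>
      ((a == c) && interchange1 v' w') ||
      match v', w' with
      | b :: v'', d :: w'' => swaps a b c d && (v'' == w'')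
      | _, _ => false
      end
  | _, _ => false
  end.

Variable n : nat.

(* With n coproducts there are never more than n (k - 1) + 1 strands, so
   bounding the positions excludes no executable sequence. *)
Definition word : finType :=
  ((n + n).-tuple (operator * 'I_(n * (k - 1)).+1))%type.

Definition steps (w : word) : seq step := [seq (x.1, val x.2) | x <- w].

Definition closed_word (w : word) : bool :=
  [&& runs 1 (steps w) 1,
      count (fun x => x.1 == Coproduct) (steps w) == n
    & count (fun x => x.1 == Product) (steps w) == n].

Definition word_equiv : rel word :=
  connect (fun v w =>
    interchange1 (steps v) (steps w) || interchange1 (steps w) (steps v)).

(* A closed prograph is an equivalence class of closed words. *)
Definition PC : {set {set word}} :=
  equivalence_partition word_equiv [set w | closed_word w].

End Prographs.

(* Main.v *)
(* Two words are equivalent under interchange exactly when they have the same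
   normal form, in which no step acts strictly to the left of the step before
   it; insertion sort computes it.  The normal words are those performed by a
   cursor that rests on one strand and moves only to the right between
   operations: a coproduct splits the strand under the cursor and leaves the
   cursor on its leftmost output, a product merges the [k] strands ending at
   the cursor and leaves the cursor on its output.  Record a letter 0 for a
   coproduct, 1 for a move to the right and 2 for a product.  If [p] and [q]
   strands lie to the left and to the right of the cursor, then
   [p = #1 - (k - 1) #2] and [q = (k - 1) #0 - #1], and nonnegativity of both
   is the lattice condition on the words that read off the row of each entry
   of a standard tableau of density [(1, k - 1, 1)]. *)

Require Import Defs.
From mathcomp Require Import all_boot zify.

Set Implicit Arguments.
Unset Strict Implicit.
Unset Printing Implicit Defensive.

(** * Comparing cardinalities through a relation *)

Lemma leq_card_rel (S T : finType) (A : {set S}) (B : {set T})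
    (R : S -> T -> bool) :
    {in A, forall x, exists2 y, y \in B & R x y} ->
    {in A &, forall x x', {in B, forall y, R x y -> R x' y -> x = x'}} ->
  #|A| <= #|B|.
Proof.
(* [pick] returns an option, so [f] is total without a default element of [T]. *)
move=> totR injR; pose f x := [pick y in B | R x y].
have fP x : x \in A -> exists2 y, f x = Some y & (y \in B) && R x y.
  move=> /totR[y By Rxy]; rewrite /f; case: pickP => [z|/(_ y)]; first by exists z.
  by rewrite By Rxy.
rewrite -(card_in_imset (f := f)); last first.
  move=> x x' Ax Ax' eq_f; have [y fx /andP[By Rxy]] := fP x Ax.
  have [y' fx' /andP[_ Rxy']] := fP x' Ax'.
  by move: eq_f Rxy'; rewrite fx fx' => -[<-]; apply: injR Rxy.
rewrite -(card_imset B Some_inj); apply/subset_leq_card/subsetP => _ /imsetP[x Ax ->].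
by have [y -> /andP[By _]] := fP x Ax; apply: imset_f.
Qed.

(** A relation replaces a pair of inverse maps: the maps needed later land in tuples of fixed length
    or with bounded positions, which can be formed only from valid arguments. *)
Lemma eq_card_rel (S T : finType) (A : {set S}) (B : {set T})
    (R : S -> T -> bool) :
    {in A, forall x, exists2 y, y \in B & R x y} ->
    {in B, forall y, exists2 x, x \in A & R x y} ->
    {in A &, forall x x', {in B, forall y, R x y -> R x' y -> x = x'}} ->
    {in B &, forall y y', {in A, forall x, R x y -> R x y' -> y = y'}} ->
  #|A| = #|B|.
Proof.
move=> totA totB injA injB; apply/eqP; rewrite eqn_leq (leq_card_rel totA injA).
exact: (leq_card_rel (R := fun y x => R x y)).
Qed.

(** * Normal forms of words *)

Section Interchange.

Variable k : nat.
Hypothesis k_gt0 : 0 < k.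

(* Here [b] is performed right after [a]; since [a] does not renumber the strands
   on its left, the position of [b] can be compared with that of [a]. *)
Definition left_of (b a : step) : bool := b.2 + inputs k b.1 <= a.2.

(* The step [a] as it reads once [b], acting on its left, has been moved before it. *)
Definition shift (b a : step) : step :=
  (a.1, a.2 - inputs k b.1 + outputs k b.1).

Lemma inputs_gt0 o : 0 < inputs k o. Proof. by case: o. Qed.
Lemma outputs_gt0 o : 0 < outputs k o. Proof. by case: o. Qed.

Lemma swapsP (a b c d : step) :
  reflect [/\ left_of a c, b = shift a c & d = a] (swaps k a b c d).
Proof.
case: a b c d => [o i] [o' j] [o'' i'] [o3 j']; rewrite /swaps /left_of /shift /=.
apply: (iffP and3P) => [[h /eqP[-> ->] /eqP[-> ->]]|[h [-> ->] [-> ->]]].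
  by split=> //=; [lia | congr pair; lia].
by split=> //=; [lia | apply/eqP; congr pair; lia].
Qed.

Lemma swaps_shift (a c : step) : left_of a c -> swaps k a (shift a c) c a.
Proof. by move=> h; apply/swapsP. Qed.

(** Interchange as rewriting in context. The pair [c], [a] in [w] is a descent and its replacement
    in [v] is not, so sorting turns [w] into [v]. *)
Lemma interchange1P (v w : seq step) :
  reflect (exists u a c y,
      [/\ left_of a c, v = u ++ [:: a, shift a c & y] & w = u ++ [:: c, a & y]])
    (interchange1 k v w).
Proof.
apply: (iffP idP) => [|[u [a [c [y [ac -> ->]]]]]]; last first.
  elim: u => [|x u IHu] /=; last by rewrite eqxx IHu.
  by rewrite swaps_shift // eqxx orbT.
elim: v w => [|a v IHv] [|c w] //= /orP[/andP[/eqP<- /IHv]|].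
  by move=> [u [b [d [y [bd -> ->]]]]]; exists (a :: u), b, d, y.
case: v w {IHv} => [|b v] [|d w] // /andP[/swapsP[ac -> ->] /eqP<-].
by exists [::], a, c, v.
Qed.

Fixpoint insert (a : step) (w : seq step) : seq step :=
  if w is b :: w' then
    if left_of b a then b :: insert (shift b a) w' else a :: w
  else [:: a].

Definition normalize (w : seq step) : seq step := foldr insert [::] w.

Definition no_descent : rel step := fun a b => ~~ left_of b a.

(** This makes the normal form an invariant. A step [e] left of [a] is passed by [a] and [c] on both
    sides; otherwise [a] stops in front of [e], and [c] ends at the same place behind [a] in either
    order. *)
Lemma insert_swap (a c : step) (w : seq step) :
  left_of a c -> insert c (insert a w) = insert a (insert (shift a c) w).
Proof.
elim: w a c => [|e w IHw] a c ac /=.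
  have -> : left_of (shift a c) a = false.
    by have := inputs_gt0 c.1; have := outputs_gt0 a.1; move: ac; rewrite /left_of /=; lia.
  by rewrite ac.
case: (boolP (left_of e a)) => [ea|nea] /=.
  have -> : left_of e c by move: ea ac; have := inputs_gt0 a.1; rewrite /left_of; lia.
  have -> : left_of e (shift a c) by move: ea ac; rewrite /left_of /=; lia.
  rewrite /= ea IHw; last by move: ea ac; rewrite /left_of /=; lia.
  (* The shifts past [e] and past [a] commute; the truncated subtractions are exact because both
     steps act on the left of [c]. *)
  congr (_ :: insert _ (insert _ w)); rewrite /shift /=; congr pair.
  by move: ea ac; rewrite /left_of /=; have := inputs_gt0 a.1; lia.
rewrite ac; case: (boolP (left_of e (shift a c))) => [es|nes] /=.
  by rewrite (negPf nea).
have -> : left_of (shift a c) a = false.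
  by have := inputs_gt0 c.1; have := outputs_gt0 a.1; move: ac; rewrite /left_of /=; lia.
by [].
Qed.

Lemma normalize_interchange (v w : seq step) :
  interchange1 k v w -> normalize v = normalize w.
Proof.
case/interchange1P=> [u [a [c [y [ac -> ->]]]]].
by rewrite /normalize !foldr_cat /= (insert_swap _ ac).
Qed.

(** Once [a] has passed [b], its new position is at least [b.2 + outputs k b.1], so it forms no
    descent with [b]. *)
Lemma insert_path (x a : step) (w : seq step) :
  no_descent x a -> path no_descent x w -> path no_descent x (insert a w).
Proof.
elim: w x a => [|b w IHw] x a /= xa; first by rewrite xa.
case/andP=> xb bw; case: ifP => [ba|/negbT ba] /=; last by rewrite xa bw /no_descent ba.
rewrite xb IHw //; move: ba; have := inputs_gt0 a.1; have := outputs_gt0 b.1.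
by rewrite /no_descent /left_of /=; lia.
Qed.

Lemma insert_sorted (a : step) (w : seq step) :
  sorted no_descent w -> sorted no_descent (insert a w).
Proof.
case: w => [|b w] //= bw; case: ifP => [ba|/negbT ba] /=; last by rewrite bw /no_descent ba.
rewrite insert_path //; move: ba; have := inputs_gt0 a.1; have := outputs_gt0 b.1.
by rewrite /no_descent /left_of /=; lia.
Qed.

Lemma normalize_sorted (w : seq step) : sorted no_descent (normalize w).
Proof. by elim: w => [|a w IHw] //=; apply: insert_sorted. Qed.

Lemma normalize_id (w : seq step) : sorted no_descent w -> normalize w = w.
Proof.
elim: w => [|a w IHw] //= aw; rewrite IHw; last exact: path_sorted aw.
by case: w aw {IHw} => [|b w] //= /andP[/negPf->].
Qed.

Lemma runs_cat_swap (a c : step) (u y : seq step) (s t : nat) : left_of a c ->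
  runs k s (u ++ [:: c, a & y]) t = runs k s (u ++ [:: a, shift a c & y]) t.
Proof.
move=> ac; elim: u s => [|[o i] u IHu] s /=; last by rewrite IHu.
case: a c ac => [o i] [o' j]; rewrite /left_of /= => ac.
have ? := inputs_gt0 o; have ? := inputs_gt0 o'.
rewrite !andbA; case: (leqP (j + inputs k o') s) => h /=.
  have -> : i + inputs k o <= s - inputs k o' + outputs k o' by lia.
  have -> : i + inputs k o <= s by lia.
  have -> /= : j - inputs k o + outputs k o + inputs k o' <=
               s - inputs k o + outputs k o by lia.
  by congr (runs _ _ _ _); lia.
case: (leqP (i + inputs k o) s) => h' //=.
by have -> : (j - inputs k o + outputs k o + inputs k o' <=
              s - inputs k o + outputs k o) = false by lia.
Qed.

(** A coproduct adds [k - 1] strands and a product adds none, which bounds the number of strands at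
    any time. *)
Lemma runs_bound (s t : nat) (w : seq step) : runs k s w t ->
  all (fun x => x.2 < s + (k - 1) * count (fun x => x.1 == Coproduct) w) w.
Proof.
elim: w s => [|[o i] w IHw] s //= /andP[h /IHw].
move=> /allP le_w; apply/andP; split.
  by apply: leq_trans (leq_addr _ _); have := inputs_gt0 o; lia.
apply/allP => x /le_w; rewrite mulnDr.
by case: o h {le_w} => /= ?; lia.
Qed.

(** * Classes of closed words and their normal representatives *)

Variable n : nat.

(** [closed_word] on raw sequences, since insertion changes positions without regard to the ordinal
    bound in [word]. *)
Definition closed_steps (v : seq step) : bool :=
  [&& runs k 1 v 1,
      count (fun x => x.1 == Coproduct) v == n
    & count (fun x => x.1 == Product) v == n].

Lemma closed_swap (a c : step) (u y : seq step) : left_of a c ->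
  closed_steps (u ++ [:: c, a & y]) = closed_steps (u ++ [:: a, shift a c & y]).
Proof.
move=> ac; rewrite /closed_steps runs_cat_swap // !count_cat /=.
by rewrite (addnCA (c.1 == Coproduct)) (addnCA (c.1 == Product)).
Qed.

Lemma steps_inj : injective (@steps k n).
Proof.
move=> v w /inj_map eq_vw; apply/val_inj/eq_vw.
by move=> [o i] [o' j] [-> /val_inj->].
Qed.

Lemma closed_steps_word (v : seq step) :
  closed_steps v -> exists w : word k n, steps w = v.
Proof.
case/and3P=> /runs_bound/allP bnd /eqP nC /eqP nP; rewrite nC in bnd.
have sz : size [seq (x.1, inord x.2 : 'I_(n * (k - 1)).+1) | x <- v] == n + n.
  rewrite size_map -[in X in _ == X + _]nC -nP -(count_predC (fun x => x.1 == Coproduct)).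
  by apply/eqP; congr (_ + _); apply: eq_count => -[[] ?].
exists (Tuple sz); rewrite /steps /= -map_comp -[RHS]map_id.
(* Starting from one strand, the bound is [1 + (k - 1) * n], the size of the ordinal type, so
   [inord] alters no position. *)
apply/eq_in_map => -[o i] /bnd /= h; congr pair; rewrite inordK // mulnC; lia.
Qed.

(** Each move of the insertion is one interchange behind the prefix [u]. It preserves closedness, so
    every intermediate sequence is again a [word] and the chain stays inside the finite type. *)
Lemma word_equiv_insert (u w : seq step) (a : step) (x : word k n) :
    closed_word x -> steps x = u ++ a :: w ->
  exists y : word k n, [/\ closed_word y, steps y = u ++ insert a w & word_equiv x y].
Proof.
elim: w u a x => [|b w IHw] u a x cx sx /=; first by exists x; split=> //; apply: connect0.
case: ifP => [ba|_]; last by exists x; split=> //; apply: connect0.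
have cl : closed_steps (rcons u b ++ shift b a :: w).
  by rewrite cat_rcons -closed_swap // -sx.
have [y sy] := closed_steps_word cl.
have [|z [cz sz yz]] := IHw (rcons u b) (shift b a) y _ sy; first by rewrite -sy in cl.
exists z; split=> //; first by rewrite sz cat_rcons.
apply: connect_trans yz; apply: connect1; apply/orP; right.
by apply/interchange1P; exists u, b, a, w; rewrite sy sx cat_rcons.
Qed.

Lemma word_equiv_normalize_cat (u w : seq step) (x : word k n) :
    closed_word x -> steps x = u ++ w ->
  exists y : word k n, [/\ closed_word y, steps y = u ++ normalize w & word_equiv x y].
Proof.
elim: w u => [|a w IHw] u cx sx; first by exists x; split=> //; apply: connect0.
rewrite -cat_rcons in sx; have [y [cy sy xy]] := IHw _ cx sx.
rewrite cat_rcons in sy; have [z [cz sz yz]] := word_equiv_insert cy sy.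
by exists z; split=> //; apply: connect_trans yz.
Qed.

Lemma word_equiv_sym : connect_sym (fun v w : word k n =>
  interchange1 k (steps v) (steps w) || interchange1 k (steps w) (steps v)).
Proof. by apply: sym_connect_sym => v w; rewrite orbC. Qed.

Lemma word_equiv_normalize (v w : word k n) :
  word_equiv v w -> normalize (steps v) = normalize (steps w).
Proof.
case/connectP=> p + ->; elim: p v => [|x p IHp] v //= /andP[vx /IHp<-].
by case/orP: vx => /normalize_interchange.
Qed.

(** Each block contains exactly one normal word: normalizing a member gives one, and two normal
    words in a block have equal normal forms, namely themselves. *)
Lemma card_PC :
  #|PC k n| = #|[set w : word k n | closed_word w & sorted no_descent (steps w)]|.
Proof.
have mem_block (x y : word k n) : y \in [set z in [set w | closed_word w] | word_equiv x z] =
    closed_word y && word_equiv x y by rewrite !inE.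
apply: (eq_card_rel (R := fun (X : {set word k n}) w => w \in X)).
- move=> X /imsetP[x + ->]; rewrite inE => cx.
  have [y [cy sy xy]] := word_equiv_normalize_cat (u := [::]) cx erefl.
  by exists y; rewrite ?mem_block ?cy // inE cy sy normalize_sorted.
- move=> w; rewrite inE => /andP[cw _].
  exists [set z in [set w | closed_word w] | word_equiv w z].
    by apply/imsetP; exists w; rewrite ?inE.
  by rewrite mem_block cw; apply: connect0.
- move=> X X' /imsetP[x _ ->] /imsetP[x' _ ->] w _; rewrite !mem_block.
  move=> /andP[_ xw] /andP[_ x'w]; apply/setP => z; rewrite !mem_block.
  congr andb; rewrite /word_equiv in xw x'w *.
  by rewrite (same_connect word_equiv_sym xw) (same_connect word_equiv_sym x'w).
- move=> w w'; rewrite !inE => /andP[_ sw] /andP[_ sw'] X /imsetP[x _ ->].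
  rewrite !mem_block => /andP[_ xw] /andP[_ xw']; apply: steps_inj.
  by rewrite -(normalize_id sw) -(normalize_id sw') -(word_equiv_normalize xw)
             -(word_equiv_normalize xw').
Qed.

End Interchange.

(** * Normal words as cursor walks *)

Definition top_row : 'I_3 := @Ordinal 3 0 isT.
Definition mid_row : 'I_3 := @Ordinal 3 1 isT.
Definition bot_row : 'I_3 := @Ordinal 3 2 isT.

Lemma row_cases (x : 'I_3) : [\/ x = top_row, x = mid_row | x = bot_row].
Proof.
case: x => [[|[|[|x]]] lt_x] //; [constructor 1|constructor 2|constructor 3];
  exact: val_inj.
Qed.

Lemma size_row_counts (w : seq 'I_3) :
  size w = count_mem top_row w + count_mem mid_row w + count_mem bot_row w.
Proof. by elim: w => //= x w ->; case: (row_cases x) => -> /=; lia. Qed.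

Section CursorWalk.

Variable k : nat.
Hypothesis k_gt1 : 1 < k.

(* [p] and [q] count the strands on the left and on the right of the cursor. *)
Fixpoint ballot (p q : nat) (w : seq 'I_3) : bool :=
  if w is x :: w' then
    if x == top_row then ballot p (q + (k - 1)) w'
    else if x == mid_row then (0 < q) && ballot p.+1 q.-1 w'
    else (k - 1 <= p) && ballot (p - (k - 1)) q w'
  else (p == 0) && (q == 0).

(** Before applying [o] at [j], the cursor must reach the rightmost input, number
    [j + inputs k o - 1]; afterwards it rests on strand [j] for either operator. *)
Fixpoint letters (p : nat) (v : seq step) : seq 'I_3 :=
  if v is (o, j) :: v' then
    nseq (j + inputs k o - 1 - p) mid_row ++
      (if o is Coproduct then top_row else bot_row) :: letters j v'
  else [::].

Fixpoint walk (p : nat) (w : seq 'I_3) : seq step :=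
  if w is x :: w' then
    if x == top_row then (Coproduct, p) :: walk p w'
    else if x == mid_row then walk p.+1 w'
    else (Product, p - (k - 1)) :: walk (p - (k - 1)) w'
  else [::].

(* Only the position [p] matters, the operator [Coproduct] is a dummy. *)
Definition walkable (p : nat) (v : seq step) : bool :=
  path (no_descent k) (Coproduct, p) v.

Lemma walkable_cons p o j v :
  walkable p ((o, j) :: v) = (p < j + inputs k o) && walkable j v.
Proof.
rewrite /walkable /= {1}/no_descent /left_of -ltnNge /=.
by case: v.
Qed.

Lemma walkable0 v : runs k 1 v 1 -> sorted (no_descent k) v -> walkable 0 v.
Proof.
case: v => [|[o i] v] //= /andP[_ _] sv; rewrite walkable_cons addn_gt0.
rewrite inputs_gt0 ?orbT; last by lia.
by move: sv; rewrite /walkable; case: v.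
Qed.

Lemma walk_nseq p m w : walk p (nseq m mid_row ++ w) = walk (p + m) w.
Proof. by elim: m p => [|m IHm] p /=; rewrite ?addn0 // IHm addnS. Qed.

Lemma ballot_nseq p q m w :
  ballot p q (nseq m mid_row ++ w) = (m <= q) && ballot (p + m) (q - m) w.
Proof.
elim: m p q => [|m IHm] p q /=; first by rewrite addn0 subn0.
by rewrite IHm; case: q => [|q] //=; rewrite addnS subSS.
Qed.

Lemma lettersK p v : walkable p v -> walk p (letters p v) = v.
Proof.
elim: v p => [|[o j] v IHv] p //; rewrite walkable_cons => /andP[pj wv].
rewrite /= walk_nseq; case: o pj => /= pj.
  by have -> : p + (j + 1 - 1 - p) = j; [lia | rewrite IHv].
by have -> : p + (j + k - 1 - p) - (k - 1) = j; [lia | rewrite IHv].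
Qed.

(** With the cursor on strand [p] of [s], there are [s - 1 - p] strands to its right; that a step
    fits into [s] strands says exactly that the moves before it are possible. *)
Lemma letters_ballot p s v :
  walkable p v -> p < s -> runs k s v 1 -> ballot p (s - 1 - p) (letters p v).
Proof.
elim: v p s => [|[o j] v IHv] p s; first by move=> _ ? /= /eqP?; lia.
rewrite walkable_cons /= => /andP[pj wv] ps /andP[js rv].
rewrite ballot_nseq; case: o pj js rv => /= pj js rv.
  have := IHv _ _ wv _ rv; set b := ballot _ _ _; set b' := ballot _ _ _.
  have -> : b = b' by rewrite /b /b'; congr ballot; lia.
  by move=> ->; lia.
have := IHv _ _ wv _ rv; set b := ballot _ _ _; set b' := ballot _ _ _.
have -> : b = b' by rewrite /b /b'; congr ballot; lia.
by move=> ->; lia.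
Qed.

Lemma walk_walkable p w : walkable p (walk p w).
Proof.
elim: w p => [|x w IHw] p //=; case: (row_cases x) => -> /=.
- by rewrite walkable_cons IHw /=; lia.
- by have := IHw p.+1; case: (walk _ _) => // [[o j] v]; rewrite !walkable_cons; lia.
- by rewrite walkable_cons IHw /=; lia.
Qed.

(** [ballot] ends with no strand on the left and only a product lowers [p], so a product must still
    come. Hence no word ends in moves, which [walk] would forget. *)
Lemma walk_neq0 p q w : 0 < p -> ballot p q w -> walk p w != [::].
Proof.
elim: w p q => [|x w IHw] p q p_gt0 /=; first by case: p p_gt0.
by case: (row_cases x) => -> //= /andP[_ /IHw]; apply.
Qed.

Lemma walkK p q w : ballot p q w -> letters p (walk p w) = w.
Proof.
elim: w p q => [|x w IHw] p q //=; case: (row_cases x) => -> /=.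
- by move=> /IHw->; have -> : p + 1 - 1 - p = 0 by lia.
(* The move is recovered as one more unit of distance to the next step, which exists by
   [walk_neq0]. *)
- case/andP=> _ bw; have := walk_neq0 (ltn0Sn p) bw; have := walk_walkable p.+1 w.
  have := IHw _ _ bw; case: (walk _ _) => // [[o j] v] /= <-.
  rewrite walkable_cons => /andP[pj _] _.
  by have -> : j + inputs k o - 1 - p = (j + inputs k o - 1 - p.+1).+1 by lia.
- case/andP=> pk /IHw->.
  by have -> : p - (k - 1) + k - 1 - p = 0 by lia.
Qed.

Lemma walk_runs p q w : ballot p q w -> runs k (p + 1 + q) (walk p w) 1.
Proof.
elim: w p q => [|x w IHw] p q /=; first by lia.
case: (row_cases x) => -> /=.
- move/IHw; have -> : p + 1 + (q + (k - 1)) = p + 1 + q - 1 + k by lia.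
  by move=> ->; lia.
- by case/andP=> q_gt0 /IHw; have -> : p.+1 + 1 + q.-1 = p + 1 + q by lia.
- case/andP=> pk /IHw; have -> : p - (k - 1) + 1 + q = p + 1 + q - k + 1 by lia.
  by move=> ->; lia.
Qed.

Lemma count_walk_top p w :
  count (fun x => x.1 == Coproduct) (walk p w) = count_mem top_row w.
Proof.
by elim: w p => [|x w IHw] p //=; case: (row_cases x) => -> /=; rewrite IHw.
Qed.

Lemma count_walk_bot p w :
  count (fun x => x.1 == Product) (walk p w) = count_mem bot_row w.
Proof.
by elim: w p => [|x w IHw] p //=; case: (row_cases x) => -> /=; rewrite IHw.
Qed.

Lemma ballot_counts p q w : ballot p q w ->
  q + (k - 1) * count_mem top_row w = count_mem mid_row w /\
  p + count_mem mid_row w = (k - 1) * count_mem bot_row w.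
Proof.
elim: w p q => [|x w IHw] p q /=; first by lia.
case: (row_cases x) => -> /=; rewrite ?add0n ?mulnDr ?muln1.
- by move/IHw => /= [? ?]; lia.
- by case/andP=> ? /IHw/= [? ?]; lia.
- by case/andP=> ? /IHw/= [? ?]; lia.
Qed.

(** The recursion unrolled into conditions on prefixes, imposed only at letters that lower a
    counter: this is the form the tableau condition takes. *)
Lemma ballotP p q w :
  reflect [/\ q + (k - 1) * count_mem top_row w = count_mem mid_row w,
              p + count_mem mid_row w = (k - 1) * count_mem bot_row w
            & forall t, t < size w ->
                (nth top_row w t = mid_row ->
                   count_mem mid_row (take t w)
                     < q + (k - 1) * count_mem top_row (take t w)) /\
                (nth top_row w t = bot_row ->
                   (k - 1) * (count_mem bot_row (take t w)).+1
                     <= p + count_mem mid_row (take t w))]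
    (ballot p q w).
Proof.
apply: (iffP idP) => [bw | []].
  have [eq1 eq2] := ballot_counts bw; split=> // {eq1 eq2}.
  elim: w p q bw => [|x w IHw] p q //=; case: (row_cases x) => -> /=.
  - move/IHw => bw [|t] //= /bw[b1 b2].
    by split=> [/b1|/b2] /=; rewrite ?mulnDr; lia.
  - case/andP=> q_gt0 /IHw bw [|t] /=; first by split=> // _; lia.
    by move=> /bw[b1 b2]; split=> [/b1|/b2] /=; lia.
  - case/andP=> pk /IHw bw [|t] /=; first by split=> // _; lia.
    by move=> /bw[b1 b2]; split=> [/b1|/b2] /=; rewrite ?mulnS; lia.
elim: w p q => [|x w IHw] p q /=; first by lia.
case: (row_cases x) => -> /= eq1 eq2 prefix; have [] := prefix 0 isT => /= p1 p2.
- apply: IHw => /=; [lia | lia |] => t lt_t; have [/= b1 b2] := prefix t.+1 lt_t.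
  by split=> [/b1|/b2] /=; rewrite ?mulnDr; lia.
- have := p1 erefl => q_gt0; apply/andP; split; first by lia.
  apply: IHw => /=; [lia | lia |] => t lt_t; have [/= b1 b2] := prefix t.+1 lt_t.
  by split=> [/b1|/b2] /=; lia.
- have := p2 erefl => pk; apply/andP; split; first by lia.
  apply: IHw => /=; [lia | lia |] => t lt_t; have [/= b1 b2] := prefix t.+1 lt_t.
  by split=> [/b1|/b2] /=; rewrite ?mulnS; lia.
Qed.

(** The three summands count coproducts, moves and products. [L] is a variable so that it can be
    instantiated with [nb_entries], which fixes the tuple type. *)
Lemma card_normal_words (n L : nat) : L = n + n * (k - 1) + n ->
  #|[set v : word k n | closed_word v & sorted (no_descent k) (steps v)]| =
  #|[set w : L.-tuple 'I_3 | ballot 0 0 w & count_mem top_row w == n]|.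
Proof.
move=> defL; have k_gt0 : 0 < k by lia.
apply: (eq_card_rel (R := fun (v : word k n) (w : L.-tuple 'I_3) => walk 0 w == steps v)).
- move=> v; rewrite inE => /andP[/and3P[rv /eqP nC /eqP nP] sv].
  have wv := walkable0 rv sv; have bv := letters_ballot wv (ltn0Sn 0) rv.
  have sz : size (letters 0 (steps v)) == L.
    have [eq1 _] := ballot_counts bv.
    rewrite size_row_counts -eq1 -(count_walk_top 0) -(count_walk_bot 0) lettersK //.
    by rewrite nC nP defL; lia.
  exists (Tuple sz); last by rewrite /= lettersK.
  by rewrite inE bv -(count_walk_top 0) lettersK //= nC.
- move=> w; rewrite inE => /andP[bw /eqP nC]; have [eq1 eq2] := ballot_counts bw.
  (* The length [L] leaves exactly [n] letters for the products. *)
  have nP : count_mem bot_row w = n.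
    have := size_row_counts w; rewrite size_tuple -eq1 nC mulnC /=; lia.
  have cw : closed_steps k n (walk 0 w).
    by rewrite /closed_steps count_walk_top count_walk_bot nC nP !eqxx (walk_runs bw).
  have [v sv] := closed_steps_word k_gt0 cw.
  exists v; last by rewrite sv.
  by rewrite inE /closed_word sv [X in X && _]cw (path_sorted (walk_walkable 0 w)).
- by move=> v v' _ _ w _ /eqP-> /eqP; apply: steps_inj.
- move=> w w'; rewrite !inE => /andP[bw _] /andP[bw' _] v _ /eqP ew /eqP ew'.
  by apply: val_inj; rewrite /= -(walkK bw) -(walkK bw') ew ew'.
Qed.

End CursorWalk.

(** * Reading words of tableaux *)

Section PrefixCounts.

Variables (M : nat) (I : eqType) (r : M.-tuple I).

Definition before (i : I) (t : nat) : nat := count_mem i (take t r).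

Lemma before0 i : before i 0 = 0. Proof. by rewrite /before take0. Qed.

Lemma beforeS i (t : 'I_M) : before i t.+1 = before i t + (tnth r t == i).
Proof.
rewrite /before (take_nth (tnth r t)) ?size_tuple // -cats1 count_cat /= addn0.
by rewrite -tnth_nth.
Qed.

Lemma leq_before i s t : s <= t -> before i s <= before i t.
Proof.
move=> st; rewrite /before -(subnKC st) takeD count_cat; exact: leq_addr.
Qed.

Lemma ltn_before i (s : 'I_M) t : tnth r s = i -> s < t -> before i s < before i t.
Proof. by move=> ri st; apply: leq_trans (leq_before i st); rewrite beforeS ri eqxx addn1. Qed.

Lemma before_total i : before i M = count_mem i r.
Proof. by rewrite /before take_oversize // size_tuple. Qed.

Lemma card_before i t : t <= M ->
  #|[set s : 'I_M | (s < t) && (tnth r s == i)]| = before i t.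
Proof.
elim: t => [|t IHt] t_le; first by rewrite before0; apply: eq_card0 => s; rewrite !inE.
pose u := Ordinal t_le; rewrite -[t]/(val u) beforeS -IHt; last exact: ltnW.
rewrite (cardsD1 u) !inE ltnSn addnC /=; congr addn.
apply: eq_card => s; rewrite !inE -val_eqE /= ltnS [s <= t]leq_eqVlt andbA.
by congr andb; case: ltngtP.
Qed.

(** Discrete intermediate values: the count starts at 0 and grows by at most one per letter. *)
Lemma before_attained i x : x <= count_mem i r -> exists2 t, t <= M & before i t = x.
Proof.
rewrite -before_total.
have : M <= M by []; elim: {1 3}M => [|t IHt] t_le.
  by rewrite before0 leqn0 => /eqP->; exists 0; rewrite ?before0.
case: (leqP x (before i t)) => [x_le _|lt_x].
  exact: IHt (ltnW t_le) x_le.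
have := beforeS i (Ordinal t_le) => /= eqS; exists t.+1 => //.
by move=> *; lia.
Qed.


Lemma card_before_lt i x : x <= count_mem i r ->
  #|[set t | (tnth r t == i) && (before i t < x)]| = x.
Proof.
case/before_attained=> t0 t0_le <-; rewrite -[RHS](card_before i t0_le).
apply: eq_card => t; rewrite !inE andbC; case: eqP => [rt|]; rewrite ?andbF // !andbT.
case: (ltnP t t0) => [|t0t]; first exact: ltn_before.
by rewrite ltnNge leq_before.
Qed.

End PrefixCounts.

Section ReadingWords.

Variables (m : nat) (la rho : m.-tuple nat).

Local Notation M := (nb_entries la rho).
Local Notation cell := (cell la).

Hypothesis la_decr : forall i j : 'I_m, j = i.+1 :> nat -> tnth la j <= tnth la i.
Hypothesis rho_gt0 : forall i, 0 < tnth rho i.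

Lemma cell_inj (c d : cell) : row_of c = row_of d -> col_of c = col_of d -> c = d.
Proof.
case: c d => [i x] [j y]; rewrite /row_of /col_of /= => eq_ij; case: j / eq_ij y => y.
by move/val_inj->.
Qed.

(** A row fills from left to right, [rho] entries per cell, so the quotient is the column of entry
    [t]. The cells of the row above, up to that column, must already be full. *)
Definition reading_word (r : M.-tuple 'I_m) : bool :=
  [forall i, count_mem i r == tnth la i * tnth rho i] &&
  [forall t, forall i : 'I_m, (tnth r t == i.+1 :> nat) ==>
     (tnth rho i * (before r (tnth r t) t %/ tnth rho (tnth r t)).+1
        <= before r i t)].

(** * From a tableau to its reading word *)

Section FromTableau.

Variable T : {ffun 'I_M -> cell}.
Hypotheses (denseT : has_density T) (stdT : is_standard T).

Local Notation row t := (row_of (T t)).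
Local Notation col t := (col_of (T t)).

Lemma card_row_cols (i : 'I_m) j : j <= tnth la i ->
  #|[set s | (row s == i) && (col s < j)]| = j * tnth rho i.
Proof.
elim: j => [|j IHj] j_le; first by apply: eq_card0 => s; rewrite !inE andbF.
pose c : cell := Tagged (fun i => 'I_(tnth la i)) (Ordinal j_le).
rewrite mulSn -IHj; last exact: ltnW.
have /eqP <- : #|[set t | T t == c]| == tnth rho i by have /forallP/(_ c) := denseT.
rewrite -cardsUI; set I := _ :&: _; have -> : I = set0.
  apply/setP=> s; rewrite !inE; apply/negbTE/negP => /andP[/eqP-> /andP[_]].
  by rewrite /col_of /= ltnn.
rewrite cards0 addn0; apply: eq_card => s; rewrite !inE ltnS leq_eqVlt.
case: (eqVneq (T s) c) => [->|neq]; first by rewrite /row_of /col_of /= !eqxx.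
case: (eqVneq (row s) i) => //= rs; case: (eqVneq (col s) j) => //= cs.
by case/eqP: neq; apply: cell_inj.
Qed.

Lemma entry_in (i : 'I_m) j : j < tnth la i -> exists t, row t = i /\ col t = j.
Proof.
move=> lt_j; pose c : cell := Tagged (fun i => 'I_(tnth la i)) (Ordinal lt_j).
have /forallP/(_ c)/eqP nb_c := denseT.
have /card_gt0P[t] : 0 < #|[set t | T t == c]| by rewrite nb_c.
by rewrite inE => /eqP Tt; exists t; rewrite Tt.
Qed.

(** [is_standard] compares adjacent cells only. Positive densities make every cell nonempty, so
    comparisons chain along the row, by induction on the column gap. *)
Lemma standard_row s t : row s = row t -> col s < col t -> s < t.
Proof.
have std u v : below (T u) (T v) || right_of (T u) (T v) -> u < v.
  by have /forallP/(_ u)/forallP/(_ v)/implyP := stdT.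
have [d] := ubnP (col t - col s); elim: d t => // d IHd t lt_d eq_r lt_c.
case: (eqVneq (col t) (col s).+1) => [eq_c|neq_c].
  by apply: std; rewrite /right_of eq_r eq_c !eqxx orbT.
have [|u [ru cu]] := @entry_in (row t) (col t).-1.
  by apply: leq_ltn_trans (leq_pred _) _; apply: ltn_ord.
have ut : u < t.
  apply: std; rewrite /right_of ru cu eqxx /= prednK ?eqxx ?orbT //.
  exact: leq_ltn_trans (leq0n _) lt_c.
by apply: ltn_trans ut; apply: IHd; rewrite ?ru ?cu //; lia.
Qed.

(** Go right along the row of [s] to the column of [t], then down; the intermediate cell exists
    because the shape is non-increasing. *)
Lemma standard_below s t : row t = (row s).+1 :> nat -> col s <= col t -> s < t.
Proof.
move=> rt le_c; have std u v : below (T u) (T v) || right_of (T u) (T v) -> u < v.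
  by have /forallP/(_ u)/forallP/(_ v)/implyP := stdT.
have [|u [ru cu]] := @entry_in (row s) (col t).
  by apply: leq_trans (la_decr rt); apply: ltn_ord.
have ut : u < t by apply: std; rewrite /below ru cu rt !eqxx.
case: (ltngtP (col s) (col t)) le_c => // [lt_c|eq_c] _.
  by apply: ltn_trans ut; apply: standard_row; rewrite ?ru ?cu.
by apply: std; rewrite /below rt eq_c !eqxx.
Qed.

Definition rows : M.-tuple 'I_m := [tuple row t | t < M].

Lemma tnth_rows t : tnth rows t = row t.
Proof. exact: tnth_mktuple. Qed.

Lemma rows_before i (t : 'I_M) :
  before rows i t = #|[set s : 'I_M | (s < t) && (row s == i)]|.
Proof.
rewrite -card_before; last exact: ltnW.
by apply: eq_card => s; rewrite !inE tnth_mktuple.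
Qed.

(** All entries in earlier columns of the row precede [t], and no entry in a later column does, so
    the number of predecessors lies between two consecutive multiples of the density. *)
Lemma col_before (t : 'I_M) :
  col t = before rows (row t) t %/ tnth rho (row t).
Proof.
have lt_t : col t < tnth la (row t) by apply: ltn_ord.
apply/esym/eqP; rewrite eqn_leq -ltnS ltn_divLR // leq_divRL // rows_before.
apply/andP; split; last first.
  rewrite -card_row_cols; last exact: ltnW.
  apply/subset_leq_card/subsetP => s; rewrite !inE => /andP[/eqP rs cs].
  by rewrite rs eqxx andbT; apply: standard_row.
rewrite -(card_row_cols lt_t); apply/proper_card/properP; split.
  apply/subsetP => s; rewrite !inE => /andP[lt_s /eqP rs]; rewrite rs eqxx ltnS leqNgt /=.
  by apply/negP => lt_c; have := standard_row (esym rs) lt_c; rewrite ltnNge ltnW.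
(* The upper bound is strict because [t] lies in its own column but not before itself. *)
by exists t; rewrite !inE ?eqxx ?ltnSn ?ltnn.
Qed.

Lemma rows_reading_word : reading_word rows.
Proof.
apply/andP; split.
  apply/forallP => i; rewrite -before_total -card_before // -card_row_cols //.
  apply/eqP/eq_card => s; rewrite !inE ltn_ord tnth_mktuple /=.
  case: eqP => //= <-; apply/esym; exact: ltn_ord.
apply/forallP => t; apply/forallP => i; rewrite tnth_mktuple; apply/implyP => /eqP rt.
rewrite -col_before rows_before mulnC -card_row_cols; last first.
  by apply: leq_trans (la_decr rt); apply: ltn_ord.
apply/subset_leq_card/subsetP => s; rewrite !inE ltnS => /andP[/eqP rs cs].
by rewrite rs eqxx andbT; apply: standard_below; rewrite ?rs.
Qed.

End FromTableau.

(** * From a reading word to a tableau *)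

Section ToTableau.

Variable r : M.-tuple 'I_m.
Hypothesis r_word : reading_word r.

Lemma reading_count i : count_mem i r = tnth la i * tnth rho i.
Proof. by case/andP: r_word => /forallP/(_ i)/eqP. Qed.

Lemma reading_lattice t (i : 'I_m) : tnth r t = i.+1 :> nat ->
  tnth rho i * (before r (tnth r t) t %/ tnth rho (tnth r t)).+1 <= before r i t.
Proof. by case/andP: r_word => _ /forallP/(_ t)/forallP/(_ i)/implyP h /eqP/h. Qed.

Lemma reading_col t :
  before r (tnth r t) t %/ tnth rho (tnth r t) < tnth la (tnth r t).
Proof.
by rewrite ltn_divLR // -reading_count -before_total; apply: ltn_before.
Qed.

Definition tableau_of : {ffun 'I_M -> cell} :=
  [ffun t => Tagged (fun i => 'I_(tnth la i)) (Ordinal (reading_col t))].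

Lemma row_tableau_of t : row_of (tableau_of t) = tnth r t.
Proof. by rewrite ffunE. Qed.

Lemma col_tableau_of t :
  col_of (tableau_of t) = before r (tnth r t) t %/ tnth rho (tnth r t).
Proof. by rewrite ffunE. Qed.

Lemma tableau_of_density : has_density tableau_of.
Proof.
apply/forallP => c; set i := row_of c; pose j := col_of c.
have lt_j : j < tnth la i by apply: ltn_ord.
(* The cell in column [j] receives the first [j.+1 * tnth rho i] occurrences of [i], minus the first
   [j * tnth rho i]. *)
have defE : [set t | tableau_of t == c] =
    [set t | (tnth r t == i) && (before r i t < j.+1 * tnth rho i)]
      :\: [set t | (tnth r t == i) && (before r i t < j * tnth rho i)].
  apply/setP => t; rewrite !inE.
  have -> : (tableau_of t == c) =
      (tnth r t == i) && (before r i t %/ tnth rho i == j).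
    apply/eqP/andP => [tc | [/eqP rt /eqP ct]].
      by rewrite -row_tableau_of tc eqxx -[i]/(row_of c) -tc row_tableau_of -col_tableau_of tc.
    by apply: cell_inj; rewrite ?row_tableau_of ?col_tableau_of rt.
  by case: eqP => //= _; rewrite eqn_leq -ltnS ltn_divLR // leq_divRL // -leqNgt andbC.
rewrite defE cardsD (setIidPr _); last first.
  apply/subsetP => t; rewrite !inE => /andP[-> lt_t] /=; apply: leq_trans lt_t _.
  by rewrite leq_mul2r leqnSn orbT.
rewrite !card_before_lt ?reading_count ?leq_mul2r ?lt_j ?(ltnW lt_j) ?orbT //.
by rewrite mulSn addnK.
Qed.

Lemma tableau_of_standard : is_standard tableau_of.
Proof.
apply/forallP => s; apply/forallP => t; apply/implyP.
rewrite /below /right_of !row_tableau_of !col_tableau_of.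
case/orP => /andP[/eqP eq_r /eqP eq_c]; rewrite ltnNge; apply/negP => le_ts.
  (* If [t <= s], the cell of [s] would be full before [t], hence before [s] itself. *)
  have := reading_lattice eq_r; rewrite eq_c => le_b.
  have := leq_trans le_b (leq_before _ _ le_ts).
  by rewrite leqNgt mulnC -ltn_divLR ?ltnSn.
have := leq_div2r (tnth rho (tnth r s)) (leq_before r (tnth r s) le_ts).
by move: eq_c; rewrite eq_r => ->; rewrite ltnn.
Qed.

End ToTableau.

(** The rows determine the tableau, since [col_before] recovers each column from them. *)
Lemma card_standard_tableaux :
  #|standard_tableaux la rho| = #|[set r | reading_word r]|.
Proof.
apply: (eq_card_rel (R := fun T r => rows T == r)).
- move=> T; rewrite inE => /andP[dT sT]; exists (rows T) => //.
  by rewrite inE rows_reading_word.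
- move=> r; rewrite inE => r_word; exists (tableau_of r_word).
    by rewrite inE tableau_of_density tableau_of_standard.
  by apply/eqP/eq_from_tnth => t; rewrite tnth_mktuple row_tableau_of.
- move=> T T'; rewrite !inE => /andP[dT sT] /andP[dT' sT'] r _ /eqP<- /eqP eq_r.
  have eq_row t : row_of (T t) = row_of (T' t).
    by rewrite -!tnth_rows eq_r.
  apply/ffunP => t; apply: cell_inj => //.
  by rewrite !col_before // eq_r eq_row.
- by move=> r r' _ _ T _ /eqP<- /eqP<-.
Qed.

End ReadingWords.

(** * Specialization to three rows of densities 1, [k - 1], 1 *)

Lemma ballot_reading_word (n k : nat) :
    1 < k ->
  forall w : (nb_entries [tuple n; n; n] [tuple 1; k - 1; 1]).-tuple 'I_3,
  (ballot k 0 0 w && (count_mem top_row w == n)) = reading_word w.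
Proof.
move=> k_gt1 w; set la := [tuple n; n; n] in w *; set rho := [tuple 1; k - 1; 1] in w *.
have rho_top : tnth rho top_row = 1 by [].
have rho_mid : tnth rho mid_row = k - 1 by [].
have rho_bot : tnth rho bot_row = 1 by [].
have k1_gt0 : 0 < k - 1 by lia.
apply/andP/andP => [[bw /eqP nT]|[/forallP counts /forallP lattice]].
  have /(ballotP k_gt1)[eq1 eq2 prefix] := bw.
  have eq_n : count_mem bot_row w = n.
    by apply/eqP; rewrite -(eqn_pmul2l k1_gt0) -eq2 -eq1 nT !add0n.
  split.
    apply/forallP => i; case: (row_cases i) => ->.
    - by rewrite nT muln1.
    - by rewrite -eq1 nT mulnC.
    - by rewrite eq_n muln1.
  apply/forallP => t; apply/forallP => i; apply/implyP.
  have [] := prefix t; first by rewrite size_tuple.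
  rewrite -tnth_nth; case: (row_cases (tnth w t)) => -> pM pB;
    case: (row_cases i) => -> // _.
  (* In the middle row, the quotient by [k - 1] is below the number of top letters exactly when a
     strand remains on the right of the cursor. *)
  - by rewrite rho_top rho_mid mul1n ltn_divLR // mulnC; apply: pM.
  - by rewrite rho_mid rho_bot divn1; apply: pB.
have /eqP nT := counts top_row; have /eqP nM := counts mid_row; have /eqP nB := counts bot_row.
rewrite rho_top muln1 in nT; rewrite rho_mid in nM; rewrite rho_bot muln1 in nB.
split; last by rewrite nT.
apply/(ballotP k_gt1); rewrite nT nM nB; split;
  [by rewrite add0n mulnC | by rewrite add0n mulnC |].
move=> t lt_t; rewrite size_tuple in lt_t.
rewrite -[t]/(val (Ordinal lt_t)) -tnth_nth.
have /forallP latt := lattice (Ordinal lt_t); split=> rt.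
  have := latt top_row; rewrite rt rho_top rho_mid mul1n ltn_divLR //= mulnC; exact.
by have := latt mid_row; rewrite rt rho_mid rho_bot divn1; exact.
Qed.

Theorem theorem2p1 (n k : nat) (hn : 1 <= n) (hk : 2 <= k) :
  #|PC k n| = #|standard_tableaux [tuple n; n; n] [tuple 1; k - 1; 1]|.
Proof.
rewrite card_PC; last exact: ltnW.
rewrite (card_normal_words hk (L := nb_entries [tuple n; n; n] [tuple 1; k - 1; 1])).
  rewrite card_standard_tableaux.
  - by apply: eq_card => w; rewrite !inE ballot_reading_word.
  - by move=> i j _; case: (row_cases i) => ->; case: (row_cases j) => ->.
  - by move=> i; case: (row_cases i) => -> //; rewrite (tnth_nth 0) /= subn_gt0.
by rewrite /nb_entries !big_ord_recl big_ord0 !(tnth_nth 0) /= !muln1 addn0 addnA.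
Qed.
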